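(* Let $r\geq 1$ and let $\mathcal{F}_r$ be the set of overpartitions in which the first occurrence of a number may be overlined and there are no $r$ consecutive parts which are all non-overlined. Then $\mathcal{F}_r$ is a separable overpartition class.
   Context: An overpartition (in the ''first occurrence'' convention) is a partition in which the first occurrence of a number may be overlined; parts are listed in non-increasing order of size, with $\overline{t}$ listed before the non-overlined copies of $t$. Consecutiveness refers to positions in this list. For a positive integer $t$ and nonnegative integer $d$, $\overline{t}+d=\overline{t+d}$. A separable overpartition class is a set $\mathcal{P}$ of overpartitions for which there is a subset $\mathcal{B}\subset\mathcal{P}$ (the basis) such that for each $m\geq 1$ the number of overpartitions in $\mathcal{B}$ with $m$ parts is finite, every overpartition in $\mathcal{P}$ with $m$ parts is uniquely of the form $(b_1+\pi_1,\ldots,b_m+\pi_m)$ with $(b_1,\ldots,b_m)\in\mathcal{B}$ and $(\pi_1,\ldots,\pi_m)$ a non-increasing sequence of nonnegative integers, and all overpartitions of this form lie in $\mathcal{P}$. *)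

(* Defs.v *)
From mathcomp Require Import all_boot.
From mathcomp Require Import classical_sets cardinality.

Set Implicit Arguments.
Unset Strict Implicit.
Unset Printing Implicit Defensive.

Local Open Scope classical_set_scope.

(* (t, true) stands for the overlined part t, (t, false) for the
   non-overlined one. *)
Definition part : Type := (nat * bool)%type.

Definition psize (p : part) : nat := p.1.
Definition overlined (p : part) : bool := p.2.

(* q may be listed immediately after p: the sizes do not increase, and among
   equal sizes only the part listed first may be overlined. *)
Definition may_follow (p q : part) : bool :=
  (psize q < psize p) || ((psize q == psize p) && ~~ overlined q).

Definition is_overpartition (l : seq part) : bool :=
  all (fun p => 0 < psize p) l && sorted may_follow l.

Definition overpartitions : set (seq part) := [set l | is_overpartition l].

Definition add_part (p : part) (d : nat) : part := (psize p + d, overlined p).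

(* zip truncates to the shorter list; this is only used for lists of equal
   length. *)
Definition add_parts (b : seq part) (pi : seq nat) : seq part :=
  [seq add_part x.1 x.2 | x <- zip b pi].

Definition is_basis (P B : set (seq part)) : Prop :=
  B `<=` P /\
  forall m : nat, 1 <= m ->
    [/\ finite_set [set b | B b /\ size b = m],
        (forall l, P l -> size l = m ->
           exists! bpi : seq part * seq nat,
             [/\ B bpi.1, size bpi.1 = m, size bpi.2 = m,
                 sorted geq bpi.2 & l = add_parts bpi.1 bpi.2])
      & (forall (b : seq part) (pi : seq nat),
           B b -> size b = m -> size pi = m -> sorted geq pi ->
           P (add_parts b pi))].

Definition separable_overpartition_class (P : set (seq part)) : Prop :=
  P `<=` overpartitions /\ exists B : set (seq part), is_basis P B.

Definition F_class (r : nat) : set (seq part) :=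
  [set l | is_overpartition l /\
           forall s : seq part, infix s l -> size s = r ->
             ~~ all (fun p => ~~ overlined p) s].

(* Main.v *)
(** Membership in [F_class r] constrains an overpartition only through its
    overlining pattern.  Among the overpartitions with a given pattern there is
    a least one, in which each part has size one plus the number of overlined
    parts listed after it.  These least overpartitions form the basis: an
    overpartition with the same pattern differs from the least one by a
    non-increasing sequence, because adjacent parts of the least one are as
    close in size as the pattern allows. *)
Require Import Defs.
From mathcomp Require Import all_boot.
From mathcomp Require Import classical_sets cardinality.
From mathcomp Require Import zify.

Set Implicit Arguments.
Unset Strict Implicit.
Unset Printing Implicit Defensive.

Local Open Scope classical_set_scope.

Fixpoint least_overpartition (o : seq bool) : seq part :=
  if o is x :: o' then ((count id o').+1, x) :: least_overpartition o'
  else [::].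

(** What is left of [l] once the least overpartition with its pattern is removed. On an
    overpartition the subtraction never truncates, by [count_overlined_lt]. *)
Fixpoint excess (l : seq part) : seq nat :=
  if l is p :: l' then (psize p - (count overlined l').+1) :: excess l'
  else [::].

(** The flag of [q], read as 0 or 1, is the smallest drop in size allowed before [q]; the listing
    rule becomes linear arithmetic. *)
Lemma may_followE (p q : part) :
  may_follow p q = (psize q + overlined q <= psize p).
Proof. rewrite /may_follow; case: (overlined q) => /=; lia. Qed.

Lemma is_overpartition_cons (p : part) (l : seq part) :
  is_overpartition (p :: l) =
  [&& 0 < psize p, (if l is q :: _ then may_follow p q else true)
    & is_overpartition l].
Proof.
rewrite /is_overpartition /=; case: l => [|q l] /=; first by rewrite !andbT.
case: (0 < psize p); case: (0 < psize q); case: (may_follow p q) => //=.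
by rewrite andbF.
Qed.

Lemma size_least_overpartition (o : seq bool) :
  size (least_overpartition o) = size o.
Proof. by elim: o => //= x o ->. Qed.

Lemma overlined_least_overpartition (o : seq bool) :
  map overlined (least_overpartition o) = o.
Proof. by elim: o => //= x o ->. Qed.

Lemma least_overpartitionP (o : seq bool) :
  is_overpartition (least_overpartition o).
Proof.
elim: o => // x o IHo; rewrite is_overpartition_cons IHo /= andbT.
by case: o {IHo} => //= y o; rewrite may_followE /psize /overlined /= addSn addnC.
Qed.

Lemma size_excess (l : seq part) : size (excess l) = size l.
Proof. by elim: l => //= p l ->. Qed.

(** Each overlined part forces a strict drop from the part before it, and the last part is
    positive. *)
Lemma count_overlined_lt (p : part) (l : seq part) :
  is_overpartition (p :: l) -> count overlined l < psize p.
Proof.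
elim: l p => [|q l IHl] p; rewrite is_overpartition_cons; first by case/andP.
case/and3P=> _; rewrite may_followE => lepq /IHl /=; lia.
Qed.

(** From a part to the next part [q] the size drops by at least [overlined q], which is exactly the
    drop at that place in the least overpartition. *)
Lemma sorted_excess (l : seq part) :
  is_overpartition l -> sorted geq (excess l).
Proof.
elim: l => // p [|q l] IHl //; rewrite is_overpartition_cons.
case/and3P=> _; rewrite may_followE => lepq ol.
have /= -> := IHl ol; rewrite andbT.
by have := count_overlined_lt ol; rewrite /geq /=; lia.
Qed.

Lemma add_parts_excess (l : seq part) : is_overpartition l ->
  add_parts (least_overpartition (map overlined l)) (excess l) = l.
Proof.
elim: l => // p l IHl ol; have ltp := count_overlined_lt ol.
move: ol; rewrite is_overpartition_cons => /and3P[_ _ /IHl {}IHl].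
rewrite /add_parts /= -/(add_parts _ _) IHl; congr (_ :: _).
rewrite /add_part /psize /overlined /= count_map /=.
by case: p ltp => s o; rewrite /psize /= => ltp; congr (_, _); apply: subnKC.
Qed.

Lemma overlined_add_parts (b : seq part) (pi : seq nat) :
  size pi = size b -> map overlined (add_parts b pi) = map overlined b.
Proof.
elim: b pi => [|p b IHb] [|d pi] //= [/IHb <-].
by rewrite /add_parts.
Qed.

Lemma add_parts_inj (b : seq part) (pi pi' : seq nat) :
  size pi = size b -> size pi' = size b ->
  add_parts b pi = add_parts b pi' -> pi = pi'.
Proof.
elim: b pi pi' => [|p b IHb] [|d pi] [|d' pi'] //= [sz] [sz'].
rewrite /add_parts /= => -[/addnI-> eqpi].
by congr (_ :: _); apply: IHb.
Qed.

(** The drop required before a part depends only on its flag, which addition keeps, and a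
    non-increasing [pi] never shrinks a drop. *)
Lemma add_parts_overpartition (b : seq part) (pi : seq nat) :
  size pi = size b -> sorted geq pi -> is_overpartition b ->
  is_overpartition (add_parts b pi).
Proof.
elim: b pi => [|p b IHb] [|d pi] //= [sz] pi_s.
rewrite is_overpartition_cons => /and3P[p_gt0 pb ob].
rewrite /add_parts /= -/(add_parts _ _) is_overpartition_cons.
rewrite IHb ?(path_sorted pi_s) // andbT /= addn_gt0 p_gt0 /=.
case: b pi pb sz pi_s {ob IHb} => [|q b] [|e pi] //= pq _ /andP[de _].
move: pq de; rewrite !may_followE /geq /add_part /psize /overlined /=; lia.
Qed.

Lemma infix_map_inv (T U : eqType) (f : T -> U) (t : seq U) (l : seq T) :
  infix t (map f l) -> exists2 s, infix s l & t = map f s.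
Proof.
(* Since [map] preserves positions, the preimage of [t] starts at offset [size p] in [l]. *)
case/infixP=> p [q eq_l]; exists (take (size t) (drop (size p) l)).
  apply/infixP; exists (take (size p) l), (drop (size t) (drop (size p) l)).
  by rewrite !cat_take_drop.
by rewrite map_take map_drop eq_l drop_size_cat // take_size_cat.
Qed.

(** A window of [r] non-overlined parts in [l'] would give one in [l] with the same flags. *)
Lemma F_class_overlined (r : nat) (l l' : seq part) :
  map overlined l = map overlined l' -> is_overpartition l' ->
  F_class r l -> F_class r l'.
Proof.
move=> eq_o ol' [_ Fl]; split=> // s sl' szs.
have: infix (map overlined s) (map overlined l).
  case/infixP: sl' => p [q eq_l']; apply/infixP.
  by exists (map overlined p), (map overlined q); rewrite eq_o eq_l' !map_cat.
case/infix_map_inv=> s' s'l eq_s.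
have szs' : size s' = r by rewrite -(size_map overlined) -eq_s size_map.
by have := Fl s' s'l szs'; rewrite -!(all_map overlined negb) eq_s.
Qed.

Theorem theorem5p2 (r : nat) (hr : 1 <= r) :
  separable_overpartition_class (F_class r).
Proof.
split; first by move=> l [].
(* Written as a fixed-point condition, membership in the basis lets [b] be recovered from its
   pattern alone. *)
exists [set b | F_class r b /\ b = least_overpartition (map overlined b)].
split=> [b []//|m _]; split.
- apply: (@sub_finite_set _ _
    ((fun t : m.-tuple bool => least_overpartition t) @` setT)).
    move=> b [[_ eq_b] szb].
    have szo : size (map overlined b) == m by rewrite size_map szb.
    by exists (Tuple szo).
  exact/finite_image/finite_finset.
- move=> l Fl szl; have ol : is_overpartition l by case: Fl.
  exists (least_overpartition (map overlined l), excess l); split=> /=.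
    split; rewrite ?size_least_overpartition ?size_excess ?size_map //.
    + split; last by rewrite overlined_least_overpartition.
      apply: F_class_overlined Fl; last exact: least_overpartitionP.
      by rewrite overlined_least_overpartition.
    + exact: sorted_excess.
    + by rewrite add_parts_excess.
  (* Uniqueness: addition keeps the flags, so [b] has the pattern of [l] and is the least
     overpartition with it; cancellation then determines [pi]. *)
  move=> [b pi] /= [[_ eq_b] szb szpi _ eq_l].
  have eq_o : map overlined l = map overlined b.
    by rewrite eq_l overlined_add_parts // szb.
  rewrite eq_o -eq_b; congr (_, _).
  apply: (@add_parts_inj b); rewrite ?size_excess ?szb //.
  by rewrite -eq_l {1}eq_b -eq_o add_parts_excess.
- move=> b pi [Fb _] szb szpi pi_s.
  have szpib : size pi = size b by rewrite szb.
  apply: F_class_overlined (Fb); first by rewrite overlined_add_parts.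
  by apply: add_parts_overpartition => //; case: Fb.
Qed.
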